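(* Consider the robust problem $$(\mathrm{R})\qquad\min_{\mathbf{x},\mathbf{y}}\ \mathbf{c}^\top\mathbf{x}+\mathbf{f}^\top\mathbf{y}\quad\text{s.t.}\quad\mathbf{a}_i^\top\mathbf{x}+\boldsymbol{\xi}_i^\top\mathbf{y}\le b_i\quad\forall\boldsymbol{\xi}_i\in\mathcal{U}_i(\mathbf{x}),\quad\forall i=1,\dots,m.$$ If each uncertainty set is a polyhedron $\mathcal{U}_i(\mathbf{x})=\{\boldsymbol{\xi}\in\mathbb{R}^p\mid\mathbf{D}_i\boldsymbol{\xi}\le\mathbf{d}_i+\boldsymbol{\Delta}_i\mathbf{x}\}$ with $\mathbf{D}_i\in\mathbb{R}^{m_i\times p}$, $\mathbf{d}_i\in\mathbb{R}^{m_i}$, $\boldsymbol{\Delta}_i=(\Delta_{ijk})_{j,k}\in\mathbb{R}^{m_i\times n}$, and if $\mathbf{x}\in\{0,1\}^n$ is binary, then the robust counterpart of $(\mathrm{R})$ is $$\begin{aligned}\min_{\mathbf{x},\mathbf{y},\mathbf{w},\boldsymbol{\pi}}\ &\mathbf{c}^\top\mathbf{x}+\mathbf{f}^\top\mathbf{y}\\ \text{s.t.}\ &\mathbf{a}_i^\top\mathbf{x}+\boldsymbol{\pi}_i^\top\mathbf{d}_i+\sum_{j=1}^{m_i}\sum_{k=1}^n\Delta_{ijk}w_{ijk}\le b_i,\quad \boldsymbol{\pi}_i^\top\mathbf{D}_i=\mathbf{y}^\top &&\forall i,\\ &w_{ijk}\le Mx_k,\quad w_{ijk}\le\pi_{ij},\quad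 w_{ijk}\ge\pi_{ij}-M(1-x_k),\quad \pi_{ij}\ge0,\quad w_{ijk}\ge0&&\forall i,j,k,\\ &\mathbf{x}\in\{0,1\}^n,\end{aligned}$$ where $M$ is a sufficiently large number.
   Context: Here $\mathbf{y}\in\mathbb{R}^p$. Indices range over $i=1,\dots,m$, $j=1,\dots,m_i$, $k=1,\dots,n$; $\boldsymbol{\pi}_i=(\pi_{i1},\dots,\pi_{im_i})$. ''Robust counterpart'' means a deterministic reformulation of $(\mathrm{R})$ in which the constraints required for all realizations of the uncertain $\boldsymbol{\xi}_i$ are replaced by finitely many constraints.
   Formalization: Each U_i(x) is assumed nonempty for all binary x; ''M sufficiently large'' means equal feasible sets for y in any bounded box, and equal optimal values and solutions if (R) is not unbounded below (otherwise values converge as M grows), as no single M works for unbounded y. *)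

(* Defs.v *)
From mathcomp Require Import all_boot all_order all_algebra.
From mathcomp Require Import all_classical all_reals all_analysis.
Import Order.TTheory GRing.Theory Num.Theory.
Import numFieldNormedType.Exports.

Set Implicit Arguments.
Unset Strict Implicit.
Unset Printing Implicit Defensive.

Local Open Scope classical_set_scope.
Local Open Scope ring_scope.

Definition dotv (R : realType) (q : nat) (u v : 'cV[R]_q) : R :=
  \sum_(l < q) u l 0 * v l 0.

Definition binary (R : realType) (n : nat) (x : 'cV[R]_n) : Prop :=
  forall k, x k 0 = 0 \/ x k 0 = 1.

Definition opt_value (R : realType) (T : Type) (F : set T) (g : T -> R)
    : \bar R :=
  ereal_inf [set (g z)%:E | z in F].

Definition minimizer (R : realType) (T : Type) (F : set T) (g : T -> R)
    (z : T) : Prop :=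
  F z /\ forall z', F z' -> g z <= g z'.

Definition objective (R : realType) (n p : nat)
    (c : 'cV[R]_n) (f : 'cV[R]_p) (u : 'cV[R]_n * 'cV[R]_p) : R :=
  dotv c u.1 + dotv f u.2.

Definition robust_feasible (R : realType) (n p m : nat)
    (a : 'I_m -> 'cV[R]_n) (b : 'I_m -> R)
    (U : 'I_m -> 'cV[R]_n -> set 'cV[R]_p) : set ('cV[R]_n * 'cV[R]_p) :=
  [set u | let: (x, y) := u in
     binary x /\
     forall i xi, U i x xi -> dotv (a i) x + dotv xi y <= b i].

Definition polyhedral_set (R : realType) (n p q : nat)
    (D : 'M[R]_(q, p)) (d : 'cV[R]_q) (Delta : 'M[R]_(q, n))
    (x : 'cV[R]_n) : set 'cV[R]_p :=
  [set xi | forall j, (D *m xi) j 0 <= (d + Delta *m x) j 0].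

(* The variables (w, pi) added by the counterpart. The i-th polyhedron has its
   own number [mi i] of rows, so both are dependent families. *)
Definition dual_vars (R : realType) (n m : nat) (mi : 'I_m -> nat) : Type :=
  ((forall i, 'M[R]_(mi i, n)) * (forall i, 'cV[R]_(mi i)))%type.

Definition counterpart_feasible (R : realType) (n p m : nat)
    (a : 'I_m -> 'cV[R]_n) (b : 'I_m -> R) (mi : 'I_m -> nat)
    (D : forall i, 'M[R]_(mi i, p)) (d : forall i, 'cV[R]_(mi i))
    (Delta : forall i, 'M[R]_(mi i, n)) (M : R) :
    set (('cV[R]_n * 'cV[R]_p) * dual_vars R n mi) :=
  [set z : ('cV[R]_n * 'cV[R]_p) * dual_vars R n mi |
   let: ((x, y), (w, pi)) := z in
     [/\ forall i,
           dotv (a i) x + dotv (pi i) (d i)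
             + \sum_(j < mi i) \sum_(k < n) Delta i j k * w i j k <= b i,
         forall i, (pi i)^T *m D i = y^T,
         forall i j k,
           [/\ w i j k <= M * x k 0,
               w i j k <= pi i j 0,
               w i j k >= pi i j 0 - M * (1 - x k 0) &
               w i j k >= 0],
         forall i j, pi i j 0 >= 0 &
         binary x]].

(* Main.v *)
(* For fixed binary x, linear programming duality turns the i-th robust constraint
   into the existence of multipliers pi_i >= 0 with pi_i^T D_i = y^T and
   a_i^T x + pi_i^T (d_i + Delta_i x) <= b_i. The constraints on w force
   w_ijk = pi_ij x_k, so the counterpart asks in addition only that pi_ij <= M.
   A multiplier may be chosen with support on independent rows of D_i; it is then
   one of finitely many linear images of y, hence bounded in terms of a bound on y
   alone, and on a box in y the extra requirement is void for large M.
   If the optimal value is finite, it is attained: for each of the finitely many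
   binary x, the problem in (y, pi) is a linear program. *)
Require Import Defs.
From mathcomp Require Import all_boot all_order all_algebra.
From mathcomp Require Import all_classical all_reals all_analysis.
From mathcomp Require Import ring lra.
Import Order.TTheory GRing.Theory Num.Theory.
Import numFieldNormedType.Exports.

Set Implicit Arguments.
Unset Strict Implicit.
Unset Printing Implicit Defensive.

Local Open Scope classical_set_scope.
Local Open Scope ring_scope.

(** * Farkas' lemma for finitely many linear forms *)

Section Forms.
Variables (R : realFieldType) (V : lmodType R).
Implicit Types (g : V -> R).

Lemma scalarZ g : scalar g -> forall a v, g (a *: v) = a * g v.
Proof.
move=> gl a v; have g0 : g 0 = 0.
  by have := gl 1 0 0; rewrite scale1r add0r mul1r => /eqP; rewrite -subr_eq subrr => /eqP.
by rewrite -[a *: v]addr0 gl g0 addr0.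
Qed.

Lemma scalarB g : scalar g -> forall u v, g (u - v) = g u - g v.
Proof. by move=> gl u v; rewrite addrC -scaleN1r gl mulN1r addrC. Qed.

(** Induction on the number of forms. If the other forms already imply [g <= 0], the first one gets
    multiplier 0. Otherwise a point [w] violating this implication must have [al ord0 w > 0], and it
    serves to eliminate the first form. *)
Lemma farkas_ord m (al : 'I_m -> V -> R) g :
  (forall i, scalar (al i)) -> scalar g ->
  (forall v, (forall i, al i v <= 0) -> g v <= 0) ->
  exists2 la : 'I_m -> R, (forall i, 0 <= la i) &
    forall v, g v = \sum_i la i * al i v.
Proof.
elim: m al g => [|m IHm] al g all gl h.
  exists (fun=> 0) => // v; rewrite big_ord0; apply/eqP; rewrite eq_le h/=; last by case.
  by rewrite -oppr_le0 -mulN1r -scalarZ// h//; case.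
have [h'|/existsNP[w /not_implyP[wle /negP]]] :=
    pselect (forall v, (forall i, al (lift ord0 i) v <= 0) -> g v <= 0).
  have [la la0 gE] := IHm _ _ (fun i => all (lift ord0 i)) gl h'.
  exists (fun i => if unlift ord0 i is Some j then la j else 0) => [i|v].
    by case: unliftP.
  rewrite big_ord_recl unlift_none mul0r add0r gE.
  by apply: eq_bigr => i _; rewrite liftK.
rewrite -ltNge => gw.
have aw : 0 < al ord0 w.
  rewrite ltNge; apply/negP => aw0; suff : g w <= 0 by rewrite leNgt gw.
  by apply: h => i; case: (unliftP ord0 i) => [j|] ->.
(* The projection along [w] onto the kernel of the first form removes that form. *)
pose P v := v - (al ord0 v / al ord0 w) *: w.
have Pl f : scalar f -> forall v, f (P v) = f v - al ord0 v / al ord0 w * f w.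
  by move=> fl v; rewrite scalarB// scalarZ.
have Ps f : scalar f -> scalar (f \o P).
  by move=> fl a u v; rewrite /= !(Pl f)// all fl; ring.
have [||v Pv|la la0 gE] := IHm (fun i => al (lift ord0 i) \o P) (g \o P).
- by move=> i; exact: Ps.
- exact: Ps.
- apply: h => i; case: (unliftP ord0 i) => [j|] ->; first exact: Pv.
  by rewrite (Pl (al ord0))// divfK ?gt_eqF// subrr.
(* The first multiplier is forced by requiring the identity to hold at [w]. *)
exists (fun i => if unlift ord0 i is Some j then la j else
   (g w - \sum_j la j * al (lift ord0 j) w) / al ord0 w) => [i|v].
  case: unliftP => // _; rewrite divr_ge0 ?ltW// subr_gt0 (le_lt_trans _ gw)//.
  by apply: sumr_le0 => j _; rewrite mulr_ge0_le0.
rewrite big_ord_recl unlift_none.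
have := gE v; rewrite /= (Pl g)// => /eqP; rewrite subr_eq => /eqP ->.
under eq_bigr do rewrite (Pl (al _))// mulrBr.
rewrite sumrB; under [X in _ = _ + X]eq_bigr do rewrite liftK.
have -> : \sum_(i < m) la i * (al ord0 v / al ord0 w * al (lift ord0 i) w) =
  al ord0 v / al ord0 w * \sum_(i < m) la i * al (lift ord0 i) w.
  by rewrite mulr_sumr; apply: eq_bigr => i _; ring.
ring.
Qed.

Lemma farkas (I : finType) (al : I -> V -> R) g :
  (forall i, scalar (al i)) -> scalar g ->
  (forall v, (forall i, al i v <= 0) -> g v <= 0) ->
  exists2 la : I -> R, (forall i, 0 <= la i) &
    forall v, g v = \sum_i la i * al i v.
Proof.
move=> all gl h.
have [v hv|la la0 gE] := @farkas_ord #|I| (fun i => al (enum_val i)) g (fun i => all (enum_val i)) gl.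
  by apply: h => i; rewrite -(enum_rankK i).
exists (la \o enum_rank) => [i|v]; first exact: la0.
rewrite gE [RHS](reindex (@enum_val I I))/=; last exact/onW_bij/enum_val_bij.
by apply: eq_bigr => i _; rewrite enum_valK.
Qed.

End Forms.

(** * Affine inequalities: infeasibility certificates, affine Farkas lemma, attainment in linear
    programs *)

Section AffineForms.
Variables (R : realFieldType) (V : lmodType R) (I : finType).
Variables (al : I -> V -> R) (e : I -> R).
Hypothesis all : forall i, scalar (al i).

(** The slice at height 1 of the half-space where this form is nonpositive is [g v <= b]. *)
Let homogenize (g : V -> R) (b : R) (u : V * R^o) : R := g u.1 - b * u.2.

Let homogenize_scalar g b : scalar g -> scalar (homogenize g b).
Proof.
move=> gl a [u r] [v s]; rewrite /homogenize/= gl.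
rewrite (_ : a *: (r : R^o) = a * r)//; ring.
Qed.

(** Infeasibility means that the homogenized system forces its height [t] to be nonpositive, so
    Farkas' lemma applies to the form [t]. *)
Lemma infeasible_certificate :
  (forall v, ~ forall i, al i v <= e i) ->
  exists la : I -> R, [/\ forall i, 0 <= la i,
    forall v, \sum_i la i * al i v = 0 & \sum_i la i * e i < 0].
Proof.
move=> h.
have [||[v t] hv|la la0 laE] := @farkas R (V * R^o)%type I
   (fun i => homogenize (al i) (e i)) (fun u => u.2 : R).
- by move=> i; exact: homogenize_scalar.
- by move=> a [u r] [v s].
- rewrite /= leNgt; apply/negP => t0; apply: (h (t^-1 *: v)) => i.
  by have := hv i; rewrite /homogenize/= subr_le0 (scalarZ (all i)) [t^-1 * _]mulrC ler_pdivrMr.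
exists la; split=> [//|v|].
- rewrite -[RHS]/((v, 0 : R^o).2 : R) laE; apply: eq_bigr => i _.
  by rewrite /homogenize/= mulr0 subr0.
have := laE (0, 1 : R^o); rewrite /homogenize/=.
under eq_bigr do rewrite -(scale0r (0 : V)) (scalarZ (all _)) mul0r mulr1 sub0r mulrN.
rewrite sumrN; lra.
Qed.

Lemma affine_farkas (g : V -> R) (b : R) (v0 : V) :
  scalar g -> (forall i, al i v0 <= e i) ->
  (forall v, (forall i, al i v <= e i) -> g v <= b) ->
  exists la : I -> R, [/\ forall i, 0 <= la i,
    forall v, g v = \sum_i la i * al i v & \sum_i la i * e i <= b].
Proof.
move=> gl hv0 h.
have [||[v t] hv|la la0 laE] := @farkas R (V * R^o)%type (I + 'I_1)%type
   (fun s u => if s is inl i then homogenize (al i) (e i) u else - u.2 : R)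
   (homogenize g b).
- case=> [i|_]; first exact: homogenize_scalar.
  by move=> a [u r] [v s] /=; rewrite (_ : a *: (r : R^o) = a * r)//; ring.
- exact: homogenize_scalar.
- have t0 : 0 <= t by have := hv (inr ord0); rewrite /= oppr_le0.
  have hvi i : al i v <= e i * t by have := hv (inl i); rewrite /homogenize/= subr_le0.
  rewrite /homogenize/= subr_le0; move: t0; rewrite le_eqVlt => /predU1P[t0|t0].
    (* At height 0 the vector [v] is a recession direction. If [g v > 0], the step [s] from [v0]
       raises [g] to [g v0 + |b - g v0| + 1], which exceeds [b]. *)
    rewrite -t0 mulr0 leNgt; apply/negP => gv.
    pose s := (`|b - g v0| + 1) / g v.
    have s0 : 0 <= s by rewrite divr_ge0// ?ltW// addr_ge0.
    have hs i : al i (s *: v + v0) <= e i.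
      rewrite all -[leRHS]add0r lerD// mulr_ge0_le0//.
      by have := hvi i; rewrite -t0 mulr0.
    have := h (s *: v + v0) hs; rewrite gl mulfVK ?gt_eqF//.
    have := ler_norm (b - g v0); lra.
  have hs i : al i (t^-1 *: v) <= e i by rewrite (scalarZ (all i)) mulrC ler_pdivrMr.
  by have := h _ hs; rewrite (scalarZ gl) mulrC ler_pdivrMr.
exists (la \o inl); split=> [i|v|]; first exact: la0.
- have := laE (v, 0 : R^o); rewrite big_sumType big_ord1 /homogenize/=.
  rewrite mulr0 subr0 oppr0 mulr0 addr0 => ->.
  by apply: eq_bigr => i _; rewrite mulr0 subr0.
(* Evaluation at height 1 over the origin shows that the multiplier of [- t <= 0] is the slack in
   the bound. *)
have := laE (0, 1 : R^o); rewrite big_sumType big_ord1 /homogenize/=.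
under eq_bigr do rewrite -(scale0r (0 : V)) (scalarZ (all _)) mul0r mulr1 sub0r mulrN.
rewrite -(scale0r (0 : V)) (scalarZ gl) mul0r mulr1 sub0r sumrN.
have := la0 (inr ord0); lra.
Qed.

End AffineForms.

(** If adding [g v <= b] made the system infeasible, the certificate would either contradict
    feasibility (weight 0 on [g]) or bound [g] below by a number above [b] (positive weight). *)
Lemma inf_attained (R : realFieldType) (V : lmodType R) (I : finType)
    (al : I -> V -> R) (e : I -> R) (g : V -> R) (b : R) :
  (forall i, scalar (al i)) -> scalar g ->
  (forall t, b < t -> exists2 v, forall i, al i v <= e i & g v < t) ->
  exists2 v, forall i, al i v <= e i & g v <= b.
Proof.
move=> all gl h; have [|v0 v0P _] := h (b + 1); first by rewrite ltrDl.
apply: contrapT => infeasible.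
have [||la [la0 laE lae]] := @infeasible_certificate R V (I + 'I_1)%type
    (fun s => if s is inl i then al i else g) (fun s => if s is inl i then e i else b).
- by case.
- move=> v hv; apply: infeasible; exists v; last exact: (hv (inr ord0)).
  by move=> i; exact: (hv (inl i)).
move: lae; rewrite big_sumType big_ord1/=.
set S := \sum_i _; set mu := la (inr ord0) => SE.
have bound v : (forall i, al i v <= e i) -> - S <= mu * g v.
  move=> vP; have := laE v; rewrite big_sumType big_ord1/= -/mu => /eqP.
  rewrite addrC addr_eq0 => /eqP ->; rewrite lerN2; apply: ler_sum => i _.
  exact: ler_wpM2l.
have := la0 (inr ord0); rewrite -/mu le_eqVlt => /predU1P[mu0|mu0].
  by have := bound _ v0P; move: SE; rewrite -mu0 !mul0r; lra.
have [|v vP] := h (- S / mu); first by rewrite ltr_pdivlMr// mulrC; lra.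
by rewrite ltr_pdivlMr// mulrC ltNge bound.
Qed.

(** * Multipliers bounded in terms of their image under [D] *)

Section BoundedMultipliers.
Variables (R : realFieldType) (q p : nat) (D : 'M[R]_(q, p)).
Implicit Types (pi la : 'rV[R]_q) (e : 'cV[R]_q).

(** A Carathéodory step: [pi] moves along a dependency of the rows in its support until an entry
    vanishes. *)
Lemma reduce_support pi la e (xi : 'cV[R]_p) :
  (forall j, (D *m xi) j 0 <= e j 0) -> (forall j, 0 <= pi 0 j) ->
  la != 0 -> la *m D = 0 -> (forall j, pi 0 j = 0 -> la 0 j = 0) ->
  exists pi', [/\ forall j, 0 <= pi' 0 j, pi' *m D = pi *m D,
    (pi' *m e) 0 0 <= (pi *m e) 0 0 &
    (#|[pred j | pi' ord0 j != 0%R]| < #|[pred j | pi ord0 j != 0%R]|)%N].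
Proof.
move=> xiP pi0 la0 laD lapi.
have [mu [muD mue mupi [j0 mu0]]] : exists mu : 'rV_q, [/\ mu *m D = 0,
    (mu *m e) 0 0 <= 0, forall j, pi 0 j = 0 -> mu 0 j = 0 & exists j, mu 0 j < 0].
  have [j laj] : exists j, la 0 j != 0 by exact/rV0Pn.
  (* A nonnegative such [nu] would certify infeasibility, against the point [xi]. So the sign of
     [la] can be chosen to keep the cost from growing. *)
  have neg nu : nu *m D = 0 -> (nu *m e) 0 0 < 0 -> exists j, nu 0 j < 0.
    move=> nuD; apply: contraPP => /forallNP nu0; apply/negP; rewrite -leNgt.
    rewrite (_ : 0 = (nu *m (D *m xi)) 0 0); last by rewrite mulmxA nuD mul0mx mxE.
    rewrite [leLHS]mxE [leRHS]mxE; apply: ler_sum => k _; apply: ler_wpM2l => //.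
    by rewrite leNgt; exact/negP/nu0.
  have opp k : pi 0 k = 0 -> (- la) 0 k = 0 by move=> /lapi; rewrite mxE => ->; rewrite oppr0.
  have laND : - la *m D = 0 by rewrite mulNmx laD oppr0.
  have laNe : (- la *m e) 0 0 = - (la *m e) 0 0 by rewrite mulNmx mxE.
  have [le0|le0|le0] := ltgtP ((la *m e) 0 0) 0.
  - by exists la; split; [| exact: ltW | | exact: neg].
  - exists (- la); split=> //; first by rewrite laNe oppr_le0 ltW.
    by apply: neg => //; rewrite laNe oppr_lt0.
  - have [lj|lj|/eqP] := ltgtP (la 0 j) 0; last by rewrite (negPf laj).
      by exists la; split; rewrite ?le0//; exists j.
    exists (- la); split=> //; first by rewrite laNe le0 oppr0.
    by exists j; rewrite mxE oppr_lt0.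
(* The largest step along [mu] that keeps the multiplier nonnegative is the least ratio. *)
pose ratio j := pi 0 j / - mu 0 j.
have [j1 muj1 j1P] := @Order.TotalTheory.arg_minP _ R _ j0 (fun j => mu 0 j < 0) ratio mu0.
have t0 : 0 <= ratio j1 by rewrite divr_ge0// oppr_ge0 ltW.
have pi'E j : (pi + ratio j1 *: mu) 0 j = pi 0 j + ratio j1 * mu 0 j by rewrite !mxE.
have pi'j1 : (pi + ratio j1 *: mu) 0 j1 = 0.
  by rewrite pi'E /ratio invrN mulrN mulNr divfK ?subrr// lt_eqF.
exists (pi + ratio j1 *: mu); split=> [j|||].
- rewrite pi'E; have [muj|muj] := ltP (mu 0 j) 0; last by rewrite addr_ge0// mulr_ge0.
  have := j1P j muj; rewrite {2}/ratio ler_pdivlMr ?oppr_gt0// mulrN; lra.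
- by rewrite mulmxDl -scalemxAl muD scaler0 addr0.
- rewrite mulmxDl -scalemxAl mxE [X in _ + X]mxE gerDl.
  exact: mulr_ge0_le0.
apply: proper_card; apply/properP; split; last exists j1.
- apply/fintype.subsetP => j; rewrite !inE; apply: contra => /eqP pij.
  by rewrite pi'E pij mupi// mulr0 addr0.
- by rewrite inE; apply/eqP => /mupi mu1; rewrite mu1 ltxx in muj1.
- by rewrite inE pi'j1 eqxx.
Qed.

Lemma independent_support pi e (xi : 'cV[R]_p) :
  (forall j, (D *m xi) j 0 <= e j 0) -> (forall j, 0 <= pi 0 j) ->
  exists pi', [/\ forall j, 0 <= pi' 0 j, pi' *m D = pi *m D,
    (pi' *m e) 0 0 <= (pi *m e) 0 0 &
    forall la, la *m D = 0 -> (forall j, pi' 0 j = 0 -> la 0 j = 0) -> la = 0].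
Proof.
move=> xiP; have [k] := ubnP #|[pred j | pi 0 j != 0]|.
elim: k pi => // k IHk pi ltk pi0.
have [?|/existsNP[la /not_implyP[laD /not_implyP[lapi /eqP la0]]]] := pselect
    (forall la, la *m D = 0 -> (forall j, pi 0 j = 0 -> la 0 j = 0) -> la = 0).
  by exists pi.
have [pi1 [pi10 pi1D pi1e ltpi1]] := reduce_support xiP pi0 la0 laD lapi.
have [|pi2 [pi20 pi2D pi2e ind]] := IHk _ _ pi10.
  by rewrite -ltnS (leq_trans _ ltk)// ltnS.
by exists pi2; split=> //; [rewrite pi2D | exact: le_trans pi2e pi1e].
Qed.

Definition coord_mx (P : {ffun 'I_q -> bool}) : 'M[R]_q := diag_mx (\row_j (P j)%:R).

(* A multiplier of y supported on P, with the rows of D in P independent, is the image of y. *)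
Definition support_inv (P : {ffun 'I_q -> bool}) : 'M[R]_(p, q) :=
  pinvmx (coord_mx P *m D) *m coord_mx P.

(** Both sides vanish off the support and have the same product with [D], so their difference is a
    dependency that [ind] kills. *)
Lemma support_invP pi :
  (forall la, la *m D = 0 -> (forall j, pi 0 j = 0 -> la 0 j = 0) -> la = 0) ->
  pi = (pi *m D) *m support_inv [ffun j => pi 0 j != 0].
Proof.
move=> ind; set P := [ffun _ => _]; set C := coord_mx P.
have mulC (v : 'rV_q) j : (v *m C) 0 j = v 0 j * (pi 0 j != 0)%:R.
  by rewrite /C /coord_mx mul_mx_diag !mxE ffunE.
have piC : pi *m C = pi.
  by apply/rowP => j; rewrite mulC; case: eqP => [->|_]; rewrite ?mul0r ?mulr1.
apply/eqP; rewrite -subr_eq0; apply/eqP/ind => [|j pij].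
  rewrite mulmxBl /support_inv -/C; apply/eqP; rewrite subr_eq0; apply/eqP.
  have -> : pi *m D = pi *m (C *m D) by rewrite mulmxA piC.
  rewrite [in RHS](mulmxA _ (pinvmx _)) -[RHS]mulmxA.
  by rewrite mulmxKpV// submxMl.
by rewrite mxE pij [X in _ + X]mxE /support_inv mulmxA mulC pij eqxx mulr0 subr0.
Qed.

Lemma bounded_multiplier :
  exists C : R, forall e pi, (exists xi : 'cV[R]_p, forall j, (D *m xi) j 0 <= e j 0) ->
    (forall j, 0 <= pi 0 j) ->
    exists pi', [/\ forall j, 0 <= pi' 0 j, pi' *m D = pi *m D,
      (pi' *m e) 0 0 <= (pi *m e) 0 0 &
      forall B, 0 <= B -> (forall l, `|(pi *m D) 0 l| <= B) -> forall j, pi' 0 j <= C * B].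
Proof.
(* Summing over all supports [P] makes the constant independent of [e] and [pi]. *)
exists (\sum_P \sum_j \sum_l `|support_inv P l j|) => e pi [xi xiP] pi0.
have [pi' [pi'0 pi'D pi'e ind]] := independent_support xiP pi0.
exists pi'; split=> // B B0 yB j.
rewrite (support_invP ind) pi'D; set P := [ffun _ => _].
apply: (@le_trans _ _ ((\sum_l `|support_inv P l j|) * B)).
  rewrite mxE mulr_suml; apply: ler_sum => l _; apply: le_trans (ler_norm _) _.
  by rewrite normrM mulrC ler_wpM2l.
apply: ler_wpM2r => //; rewrite (bigD1 P)//= (bigD1 j)//= -addrA lerDl.
by apply: addr_ge0; apply: sumr_ge0 => *; rewrite ?sumr_ge0// => *; rewrite sumr_ge0.
Qed.

End BoundedMultipliers.

Lemma dotvE (R : realType) q (u v : 'cV[R]_q) : dotv u v = (u^T *m v) 0 0.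
Proof. by rewrite mxE; apply: eq_bigr => l _; rewrite mxE. Qed.

Lemma dotvC (R : realType) q (u v : 'cV[R]_q) : dotv u v = dotv v u.
Proof. by apply: eq_bigr => l _; rewrite mulrC. Qed.

Lemma ler_dotv (R : realType) q (u v w : 'cV[R]_q) :
  (forall l, 0 <= u l 0) -> (forall l, v l 0 <= w l 0) -> dotv u v <= dotv u w.
Proof. by move=> u0 vw; apply: ler_sum => l _; apply: ler_wpM2l. Qed.

Lemma minimizer_opt_value (R : realType) T (F : set T) (g : T -> R) z :
  minimizer F g z -> opt_value F g = (g z)%:E.
Proof.
move=> [Fz zmin]; apply/eqP; rewrite eq_le; apply/andP; split.
  by apply: ereal_inf_lbound; exists z.
by apply/ereal_infP => _ [z' Fz' <-]; rewrite lee_fin zmin.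
Qed.

Lemma opt_value_le (R : realType) T (F : set T) (g : T -> R) z :
  F z -> (opt_value F g <= (g z)%:E)%E.
Proof. by move=> Fz; apply: ereal_inf_lbound; exists z. Qed.

(** * Robust constraints, dual certificates and the counterpart *)

Section Counterpart.
Variables (R : realType) (n p m : nat).
Variables (a : 'I_m -> 'cV[R]_n) (b : 'I_m -> R) (mi : 'I_m -> nat).
Variables (D : forall i, 'M[R]_(mi i, p)) (d : forall i, 'cV[R]_(mi i)).
Variables (Delta : forall i, 'M[R]_(mi i, n)).
Variable U : 'I_m -> 'cV[R]_n -> set 'cV[R]_p.
Hypothesis hU : forall i x, U i x = polyhedral_set (D i) (d i) (Delta i) x.
Hypothesis hne : forall i x, binary x -> U i x !=set0.

Let RF := robust_feasible a b U.
Let CF := counterpart_feasible a b D d Delta.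

(** Dual feasibility for maximizing [dotv xi y] over [U i x]. The product of [pi] and [x] is still
    bilinear, and [pi] has no upper bound. *)
Definition dual_certificate (x : 'cV[R]_n) (y : 'cV[R]_p)
    (pi : forall i, 'cV[R]_(mi i)) :=
  forall i, [/\ forall j, 0 <= pi i j 0, (pi i)^T *m D i = y^T &
    dotv (a i) x + dotv (pi i) (d i + Delta i *m x) <= b i].

Lemma dotv_affine i (x : 'cV[R]_n) (w : 'M[R]_(mi i, n)) (pi : 'cV[R]_(mi i)) :
  (forall j k, w j k = pi j 0 * x k 0) ->
  dotv pi (d i) + \sum_(j < mi i) \sum_(k < n) Delta i j k * w j k =
  dotv pi (d i + Delta i *m x).
Proof.
move=> wE; rewrite -big_split/=; apply: eq_bigr => j _.
rewrite [in RHS]mxE [X in _ * (_ + X)]mxE mulrDr mulr_sumr; congr (_ + _).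
by apply: eq_bigr => k _; rewrite wE mulrCA.
Qed.

Lemma counterpart_certificate M x y w pi :
  CF M ((x, y), (w, pi)) -> dual_certificate x y pi.
Proof.
move=> [h1 h2 h3 h4 xb] i; split=> //; have := h1 i; rewrite -addrA (@dotv_affine _ x)// => j k.
have [] := h3 i j k; have [->|->] := xb k.
  by rewrite !mulr0 => w0 _ _ w0'; apply/eqP; rewrite eq_le w0.
by rewrite subrr !mulr0 !mulr1 subr0 => _ w1 w2 _; apply/eqP; rewrite eq_le w1.
Qed.

(** The bound by [M] enters as [w <= M] where [x k 0 = 1] and as [pi - M <= 0] where [x k 0 = 0]. *)
Lemma certificate_counterpart M x y pi : binary x -> dual_certificate x y pi ->
  (forall i j, pi i j 0 <= M) ->
  CF M ((x, y), (fun i => \matrix_(j, k) (pi i j 0 * x k 0), pi)).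
Proof.
move=> xb cert piM; split=> // [i|i|i j k|i j].
- rewrite -addrA (@dotv_affine _ x); first by have [] := cert i.
  by move=> j k; rewrite mxE.
- by have [] := cert i.
- have [pi0 _ _] := cert i; rewrite mxE; have [->|->] := xb k.
    by rewrite !mulr0 subr0 mulr1 subr_le0.
  by rewrite subrr !mulr1 mulr0 subr0.
- by have [] := cert i.
Qed.

(** Weak duality. *)
Lemma certificate_robust x y pi : binary x -> dual_certificate x y pi -> RF (x, y).
Proof.
move=> xb cert; split=> // i xi; rewrite hU => xiP; have [pi0 piD piE] := cert i.
apply: le_trans piE; rewrite lerD2l dotvC dotvE -piD -mulmxA -dotvE.
exact: ler_dotv.
Qed.

(** Strong duality; [hne] supplies the feasible point that [affine_farkas] requires. *)
Lemma polyhedron_farkas i x (y : 'cV[R]_p) (be : R) : binary x ->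
  (forall xi, U i x xi -> dotv xi y <= be) ->
  exists pi : 'cV[R]_(mi i), [/\ forall j, 0 <= pi j 0, pi^T *m D i = y^T &
    dotv pi (d i + Delta i *m x) <= be].
Proof.
move=> xb h; have [xi0] := hne i xb; rewrite hU => xi0P.
have row_scalar j : scalar (fun xi : 'cV[R]_p => (D i *m xi) j 0).
  by move=> r u v; rewrite mulmxDr -scalemxAr !mxE.
have dot_scalar : scalar (fun xi : 'cV[R]_p => dotv xi y).
  move=> r u v; rewrite /dotv mulr_sumr -big_split; apply: eq_bigr => l _/=.
  by rewrite !mxE mulrDl mulrA.
have [xi hxi|la [la0 laE lae]] := affine_farkas row_scalar (b := be) dot_scalar xi0P.
  by apply: h; rewrite hU.
exists (\col_j la j); split=> [j||]; first by rewrite mxE.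
(* The identity of linear forms is read off at the unit vectors. *)
- apply/rowP => l; rewrite mxE mxE -[RHS]mul1r.
  have := laE (delta_mx l 0).
  rewrite {1}/dotv (bigD1 l)//= big1 ?addr0 => [|k kl]; last first.
    by rewrite mxE (negPf kl) mul0r.
  rewrite mxE !eqxx/= => ->; apply: eq_bigr => j _; rewrite !mxE.
  congr (_ * _); rewrite (bigD1 l)//= big1 ?addr0 => [|k kl].
    by rewrite mxE !eqxx mulr1.
  by rewrite mxE (negPf kl) mulr0.
- by under [leLHS]eq_bigr do rewrite mxE.
Qed.

Lemma bounded_certificate : exists K : R, forall (B : R) x (y : 'cV[R]_p), 0 <= B ->
  (forall l, `|y l 0| <= B) -> RF (x, y) ->
  exists2 pi, dual_certificate x y pi & forall i j, pi i j 0 <= K * B.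
Proof.
pose C i := sval (cid (bounded_multiplier (D i))).
(* Each [C i] depends on [D i] alone, so one constant serves all [x], [y] and [B]. *)
exists (\sum_i `|C i|) => B x y B0 yB [xb xyP].
have piP i : exists pi : 'cV[R]_(mi i), [/\ forall j, 0 <= pi j 0, pi^T *m D i = y^T,
    dotv (a i) x + dotv pi (d i + Delta i *m x) <= b i & forall j, pi j 0 <= C i * B].
  have [|pi [pi0 piD pie]] := @polyhedron_farkas i x y (b i - dotv (a i) x) xb.
    by move=> xi /xyP; rewrite lerBrDl.
  have := svalP (cid (bounded_multiplier (D i))) (d i + Delta i *m x) pi^T.
  rewrite -/(C i); case=> [||pi' [pi'0 pi'D pi'e pi'B]].
  - by have [xi] := hne i xb; rewrite hU; exists xi.
  - by move=> j; rewrite mxE.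
  exists pi'^T; split=> [j|||j]; rewrite ?mxE ?trmxK ?pi'D//.
  - by rewrite -lerBrDl (le_trans _ pie)// dotvE trmxK dotvE.
  - by apply: pi'B => // l; rewrite piD mxE.
exists (fun i => sval (cid (piP i))) => i; first by have [] := svalP (cid (piP i)).
move=> j; have [_ _ _ /(_ j)/le_trans] := svalP (cid (piP i)); apply.
apply: ler_wpM2r => //; apply: le_trans (ler_norm _) _.
by rewrite (bigD1 i)//= lerDl sumr_ge0.
Qed.

Lemma counterpart_robust M u v : CF M (u, v) -> RF u.
Proof.
move: u v => [x y] [w pi] uv; have [_ _ _ _ xb] := uv.
exact: certificate_robust xb (counterpart_certificate uv).
Qed.

Lemma robust_counterpart (B : R) :
  \forall M \near +oo, forall (x : 'cV[R]_n) (y : 'cV[R]_p),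
    (forall l, `|y l 0| <= B) -> (RF (x, y) <-> exists v, CF M ((x, y), v)).
Proof.
have [K KP] := bounded_certificate.
near=> M => x y yB; split=> [xyP|[v]]; last exact: counterpart_robust.
have [|pi cert piK] := KP `|B| x y (normr_ge0 _) _ xyP.
  by move=> l; exact: le_trans (yB l) (ler_norm _).
exists (fun i => \matrix_(j, k) (pi i j 0 * x k 0), pi).
apply: certificate_counterpart => //; first by case: xyP.
move=> i j; apply: le_trans (piK i j) _; near: M; apply: nbhs_pinfty_ge; exact: num_real.
Unshelve. all: by end_near. Qed.

Lemma robust_counterpart_point u : RF u -> \forall M \near +oo, exists v, CF M (u, v).
Proof.
case: u => x y xyP; near=> M.
(* The sum of the absolute entries of [y] is the radius of a box containing [y]. *)
have h : forall (x : 'cV[R]_n) (y' : 'cV[R]_p), (forall l, `|y' l 0| <= \sum_l `|y l 0|) ->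
  (RF (x, y') <-> exists v, CF M ((x, y'), v)).
  by near: M; exact: robust_counterpart.
by apply/h => // l; rewrite (bigD1 l)//= lerDl sumr_ge0.
Unshelve. all: by end_near. Qed.

(** For fixed [x] the feasible [y] are the projection of the polyhedron of pairs [(y, pi)] cut out
    by the dual certificate. *)
Lemma robust_inf_attained (f : 'cV[R]_p) x (r : R) : binary x ->
  (forall t, r < t -> exists2 y, RF (x, y) & dotv f y < t) ->
  exists2 y, RF (x, y) & dotv f y <= r.
Proof.
move=> xb h; have [K KP] := bounded_certificate.
pose T := {i : 'I_m & 'I_(mi i)}.
pose V := ('cV[R]_p * (T -> R^o))%type.
pose val (v : V) (i : 'I_m) (j : 'I_(mi i)) : R := v.2 (Tagged (fun i => 'I_(mi i)) j : T).
(* The boolean [s] splits each equation of [pi^T D = y^T] into two opposite inequalities. *)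
pose al (s : 'I_m + T + 'I_m * 'I_p * bool) (v : V) : R := match s with
  | inl (inl i) => \sum_j val v i j * (d i + Delta i *m x) j 0
  | inl (inr t) => - v.2 t
  | inr (i, l, s) => (-1) ^+ s * (\sum_j val v i j * D i j l - v.1 l 0)
  end.
pose e (s : 'I_m + T + 'I_m * 'I_p * bool) : R :=
  if s is inl (inl i) then b i - dotv (a i) x else 0.
have als s : scalar (al s).
  have sum_scalar i (c : 'I_(mi i) -> R) r' (u v : V) :
    \sum_j val (r' *: u + v) i j * c j =
    r' * (\sum_j val u i j * c j) + \sum_j val v i j * c j.
    rewrite mulr_sumr -big_split; apply: eq_bigr => j _ /=.
    by rewrite mulrA -mulrDl.
  move: s => [[i|t]|[[i l] s]] r' u v; rewrite /al.
  - exact: sum_scalar.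
  - by rewrite -[(r' *: u + v).2 t]/(r' * u.2 t + v.2 t); ring.
  - by rewrite sum_scalar !mxE; ring.
have certP (v : V) : (forall s, al s v <= e s) <->
    dual_certificate x v.1 (fun i => \col_j val v i j).
  split=> [vP i|cert [[i|[i j]]|[[i l] s]]].
  - split=> [j||].
    + by have := vP (inl (inr (Tagged _ j))); rewrite mxE oppr_le0.
    + apply/rowP => l; rewrite !mxE; under eq_bigr do rewrite !mxE.
      apply/eqP; rewrite -subr_eq0 eq_le.
      have := vP (inr (i, l, false)); have := vP (inr (i, l, true)).
      by rewrite /al /e expr0 expr1 mul1r mulN1r oppr_le0 => -> ->.
    + rewrite -lerBrDl; have := vP (inl (inl i)); rewrite /al /e; apply: le_trans.
      by rewrite le_eqVlt; apply/orP; left; apply/eqP/eq_bigr => j _; rewrite mxE.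
  - have [_ _] := cert i; rewrite /al /e -lerBrDl; apply: le_trans.
    by rewrite le_eqVlt; apply/orP; left; apply/eqP/eq_bigr => j _; rewrite !mxE.
  - have [/(_ j) + _ _] := cert i; by rewrite mxE /al /e oppr_le0.
  - have [_ + _] := cert i => /rowP/(_ l); rewrite !mxE.
    under eq_bigr do rewrite !mxE.
    by rewrite /al /e => ->; rewrite subrr mulr0.
have f_scalar : scalar (fun v : V => dotv f v.1).
  move=> r' u v; rewrite /dotv mulr_sumr -big_split; apply: eq_bigr => l _/=.
  by rewrite !mxE mulrDr mulrCA.
have [t rt|v /certP vP vr] := @inf_attained R V _ al e (fun v => dotv f v.1) r als f_scalar.
  have [y xyP yt] := h t rt.
  have [|l|//|pi cert _] := KP (\sum_l `|y l 0|) x y; first exact: sumr_ge0.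
    by rewrite (bigD1 l)//= lerDl sumr_ge0.
  exists (y, fun t : T => pi (tag t) (tagged t) 0) => //.
  apply/certP => i; have [pi0 piD piE] := cert i.
  by rewrite (_ : \col_j _ = pi i)//; apply/colP => j; rewrite mxE.
by exists v.1 => //; exact: certificate_robust vP.
Qed.

(** * Optimal values and minimizers as [M] grows *)

Section OptimalValues.
Variables (c : 'cV[R]_n) (f : 'cV[R]_p).

Let obj := objective c f.
Let cobj (z : ('cV[R]_n * 'cV[R]_p) * dual_vars R n mi) := obj z.1.

Lemma opt_value_robust_le M : (opt_value RF obj <= opt_value (CF M) cobj)%E.
Proof.
apply/ereal_infP => _ [[u v] uv <-]; apply: opt_value_le.
exact: counterpart_robust uv.
Qed.

Lemma robust_minimizer (r : R) : opt_value RF obj = r%:E -> exists u, minimizer RF obj u.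
Proof.
move=> optE.
have lb u : RF u -> r <= obj u by move=> /(opt_value_le obj); rewrite optE lee_fin.
suff [x [y xyP xyr]] : exists x, exists2 y, RF (x, y) & obj (x, y) <= r.
  by exists (x, y); split=> // z /lb; exact: le_trans.
apply: contrapT => /forallNP none.
pose vec (s : {ffun 'I_n -> bool}) : 'cV[R]_n := \col_k (s k)%:R.
have vecb s : binary (vec s) by move=> k; rewrite mxE; case: (s k); [right|left].
(* If no binary [x] attains [r], each leaves a gap above [r]. As there are finitely many, a common
   [t > r] bounds the objective below, which contradicts [optE]. *)
have gap s : \forall t \near r^'+, forall y, RF (vec s, y) -> t <= obj (vec s, y).
  have [t [rt tP]] : exists t, r < t /\ forall y, RF (vec s, y) -> t <= obj (vec s, y).
    apply: contrapT => /forallNP nogap; apply: (none (vec s)).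
    have [t rt|y xyP yr] := @robust_inf_attained f (vec s) (r - dotv c (vec s)) (vecb s).
      apply: contrapT => noy; apply: (nogap (dotv c (vec s) + t)); split=> [|y xyP].
        by rewrite -ltrBlDl.
      rewrite leNgt; apply/negP => yt; apply: noy; exists y => //.
      by rewrite -(ltrD2l (dotv c (vec s))).
    by exists y => //; rewrite /obj/objective/= -lerBrDl.
  near=> t' => y /tP; apply: le_trans; near: t'; exact: nbhs_right_le.
have [t [rt tP]] : exists t, r < t /\ forall s y, RF (vec s, y) -> t <= obj (vec s, y).
  apply: (@filter_ex _ (r^'+)); near=> t; split; first by near: t; exact: nbhs_right_gt.
  near: t; exact: filter_forall.
have : (t%:E <= opt_value RF obj)%E.
  apply/ereal_infP => _ [[x y] xyP <-]; rewrite lee_fin.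
  have [xb _] := xyP.
  suff xE : x = vec [ffun k => x k 0 == 1] by rewrite xE; apply: tP; rewrite -xE.
  apply/colP => k; rewrite mxE ffunE; case: (xb k) => ->; last by rewrite eqxx.
  by rewrite eq_sym oner_eq0.
by rewrite optE lee_fin leNgt rt.
Unshelve. all: by end_near. Qed.

(** Counterpart points are robust feasible with the same objective, so [u] stays optimal once it
    extends to a counterpart point. *)
Lemma minimizer_counterpart u : minimizer RF obj u ->
  \forall M \near +oo, exists v, minimizer (CF M) cobj (u, v).
Proof.
move=> [uP umin]; near=> M.
have [v uv] : exists v, CF M (u, v) by near: M; exact: robust_counterpart_point.
by exists v; split=> // -[u' v'] /counterpart_robust; exact: umin.
Unshelve. all: by end_near. Qed.

Lemma opt_value_counterpart_eq : (-oo < opt_value RF obj)%E ->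
  \forall M \near +oo, opt_value (CF M) cobj = opt_value RF obj.
Proof.
case optE : (opt_value RF obj) => [r| |] // _.
  have [u umin] := robust_minimizer optE; near=> M.
  have [v uvmin] : exists v, minimizer (CF M) cobj (u, v).
    by near: M; exact: minimizer_counterpart.
  by rewrite (minimizer_opt_value uvmin) -optE (minimizer_opt_value umin).
(* If the robust problem has value [+oo], the counterpart, whose value is no smaller, has it too. *)
by near=> M; apply/eqP; rewrite -leye_eq -optE; exact: opt_value_robust_le.
Unshelve. all: by end_near. Qed.

Lemma cvg_opt_value_counterpart :
  opt_value (CF M) cobj @[M --> +oo] --> opt_value RF obj.
Proof.
have [optE|] := eqVneq (opt_value RF obj) -oo%E; last first.
  rewrite -ltNye => /opt_value_counterpart_eq opt_eq.
  exact: cvg_near_cst.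
(* In the unbounded case, a robust point with objective below [A] extends to a counterpart point for
   all large [M]. *)
rewrite optE; apply/cvgeNyPle => A.
have [_ [u uP <-] uA] : exists2 z, [set (obj z)%:E | z in RF] z & (z < A%:E)%E.
  by apply: ereal_inf_lt; rewrite -/(opt_value RF obj) optE ltNyr.
near=> M; have [v uv] : exists v, CF M (u, v) by near: M; exact: robust_counterpart_point.
exact: le_trans (opt_value_le cobj uv) (ltW uA).
Unshelve. all: by end_near. Qed.

Lemma minimizer_robust M u v : opt_value (CF M) cobj = opt_value RF obj ->
  minimizer (CF M) cobj (u, v) -> minimizer RF obj u.
Proof.
move=> opt_eq uvmin; split=> [|z zP]; first exact: counterpart_robust (proj1 uvmin).
by rewrite -lee_fin -[leLHS](minimizer_opt_value uvmin) opt_eq opt_value_le.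
Qed.

End OptimalValues.
End Counterpart.

Theorem proposition4 (R : realType) (n p m : nat)
    (c : 'cV[R]_n) (f : 'cV[R]_p) (a : 'I_m -> 'cV[R]_n) (b : 'I_m -> R)
    (mi : 'I_m -> nat)
    (D : forall i, 'M[R]_(mi i, p)) (d : forall i, 'cV[R]_(mi i))
    (Delta : forall i, 'M[R]_(mi i, n))
    (U : 'I_m -> 'cV[R]_n -> set 'cV[R]_p)
    (hU : forall i x, U i x = polyhedral_set (D i) (d i) (Delta i) x)
    (hne : forall i x, binary x -> U i x !=set0) :
  let RF := robust_feasible a b U in
  let CF := counterpart_feasible a b D d Delta in
  let obj := objective c f in
  let cobj := fun z : ('cV[R]_n * 'cV[R]_p) * dual_vars R n mi => obj z.1 in
  [/\ (* every feasible point of the counterpart is robust feasible *)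
      forall M u v, CF M (u, v) -> RF u,
      (* on every box in y, the feasible sets agree for all large M *)
      forall B : R, \forall M \near +oo, forall (x : 'cV[R]_n) (y : 'cV[R]_p),
        (forall l, `|y l 0| <= B) ->
        (RF (x, y) <-> exists v, CF M ((x, y), v)),
      (* the optimal values converge, also if (R) is unbounded *)
      opt_value (CF M) cobj @[M --> +oo] --> opt_value RF obj,
      (* if (R) is not unbounded, the problems agree for all large M *)
      (-oo < opt_value RF obj)%E ->
        \forall M \near +oo,
          opt_value (CF M) cobj = opt_value RF obj /\
          (forall u v, minimizer (CF M) cobj (u, v) -> minimizer RF obj u) &
      (* every optimal solution of (R) is recovered for all large M *)
      forall u, minimizer RF obj u ->
        \forall M \near +oo, exists v, minimizer (CF M) cobj (u, v)].
Proof.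
move=> RF CF obj cobj; split.
- by move=> M u v; exact: counterpart_robust.
- exact: robust_counterpart.
- exact: cvg_opt_value_counterpart.
- move=> /opt_value_counterpart_eq opt_eq.
  have {}opt_eq := opt_eq _ _ _ _ hU hne.
  near=> M; have opt_M : opt_value (CF M) cobj = opt_value RF obj by near: M.
  by split=> // u v; exact: minimizer_robust.
- by move=> u; exact: minimizer_counterpart.
Unshelve. all: by end_near. Qed.
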